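(* Let $\mathbb{R}=(\omega,E)$ be a Rado graph, $T\in\mathcal{T}_{\mathbb{R}}$, $n<\omega$ and $D=r_n(T)$. Let $A\in\widehat{\mathcal{AT}}(T)$ with $\max(A)\subseteq\max(D)$, let $k<\omega$ and let $B\in\widehat{\mathcal{AT}}$ be such that one of the following holds: (a) $k\ge1$, $A\in\mathcal{AT}_k(T)$, and $B=A^+$; (b) $A$ has at least one node, $\mathrm{card}(\max(A))=2^k$, and $B=A\cup Y$ where $Y\subseteq\max(A^+)$ contains exactly one immediate successor of each node of $\max(A)$. Let $h:r_{k+1}[B,T]^*\to 2$ be any coloring. Then there is $S\in[D,T]$ such that $h$ is constant on $r_{k+1}[B,S]^*$.
   Context: Notation. $\mathbb{S}=\bigcup_{n<\omega}2^n$ is the set of finite sequences of $0$s and $1$s; $|s|$ is the length of $s$, $s\restriction m$ its restriction to $m\le|s|$; $s\subseteq t$ means $s=t\restriction m$ for some $m\le|t|$. The meet $s\wedge t$ is $s\restriction m$ for the maximal $m$ with $s\restriction m=t\restriction m$. For $\subseteq$-incomparable $s,t$, $s<_{\mathrm{lex}}t$ iff $s(|s\wedge t|)<t(|s\wedge t|)$. A tree is a set $T\subseteq\mathbb{S}$ with a set of levels $L\subseteq\omega$ such that $|t|\in L$ for all $t\in T$ and $t\restriction l\in T$ whenever $t\in T$, $l\in L$, $l<|t|$. A tree with coding nodes is a tree $T$ with an injection $n\mapsto c^T_n$ from some $N\le\omega$ into $T$ such that $|c^T_m|<|c^T_n|$ for $m<n<N$; write $l^T_n=|c^T_n|$. For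 trees with coding nodes $S,T$, a strong similarity $f:S\to T$ is a bijection such that for all $s,t,u,v\in S$: (1) $s<_{\mathrm{lex}}t$ iff $f(s)<_{\mathrm{lex}}f(t)$; (2) $s\wedge t\subseteq u\wedge v$ iff $f(s)\wedge f(t)\subseteq f(u)\wedge f(v)$; (3) $f(s\wedge t)=f(s)\wedge f(t)$; (4) $|s\wedge t|<|u\wedge v|$ iff $|f(s)\wedge f(t)|<|f(u)\wedge f(v)|$; (5) if $|s|<|t|$ then $f(t)(|f(s)|)=t(|s|)$; (6) $f$ maps the set of coding nodes of $S$ onto the set of coding nodes of $T$. $\mathbb{S}_{\mathbb{R}}$ is the tree $\mathbb{S}$ (levels $\omega$) with coding nodes $c_n$ where $c_n$ is the node of length $n$ with $c_n(m)=1$ iff $n\,E\,m$, for $m<n$. $\mathcal{T}_{\mathbb{R}}$ is the set of all images $f[\mathbb{S}_{\mathbb{R}}]$ of maps $f$ that are strong similarities of $\mathbb{S}_{\mathbb{R}}$ onto their image (coding nodes $c^T_n=f(c_n)$). $S\le T$ iff $S\subseteq T$. $r_k(T)$ is the set of nodes of $T$ of length $<l^T_k$; $\mathcal{AT}_k=\{r_k(T):T\in\mathcal{T}_{\mathbb{R}}\}$, $\mathcal{AT}=\bigcup_k\mathcal{AT}_k$; $\mathcal{AT}_k(T)$, $\mathcal{AT}(T)$ are the members contained in $T$. For $A\in\mathcal{AT}$, $[A,T]=\{S\in\mathcal{T}_{\mathbb{R}}:S\le T,\ \exists j\ r_j(S)=A\}$. For finite $A\subseteq\mathbb{S}$: $l_A=\max\{|t|:t\in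 A\}$; $\max(A)$ is the set of maximal nodes of $A$; for $l\le l_A$, $A\!\restriction_{\le}\! l=\{t\in A:|t|<l\}\cup\{t\restriction l:t\in A,|t|\ge l\}$; $A^+=A\cup\{s^\frown i:s\in\max(A),i\in\{0,1\}\}$. $\widehat{\mathcal{AT}}=\{A\!\restriction_{\le}\!l:A\in\mathcal{AT},l\le l_A\}$; with $L_T=\{|t|:t\in T\}$, $\widehat{\mathcal{AT}}(T)=\{A\!\restriction_{\le}\!l:A\in\mathcal{AT}(T),l\in L_T\}$. A finite set $Y$ end-extends a finite set $X$ if there is a bijection $g:X\to Y$ with $x\subseteq g(x)$ for all $x$. For such $B$, let $m$ be least such that some $C\in\mathcal{AT}_m$ has $\max(C)$ end-extending $\max(B)$; $[B,T]^*=\{S\in\mathcal{T}_{\mathbb{R}}:S\le T,\ \max(r_m(S))\text{ end-extends }\max(B)\}$ and for $j\ge m$, $r_j[B,T]^*=\{r_j(S):S\in[B,T]^*\}$ (equivalently, $\{C\in\mathcal{AT}_j(T):\max(C)\text{ end-extends }\max(B)\}$). *)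

(* Defs.v *)
From mathcomp Require Import all_boot finmap.
From mathcomp Require Import boolp classical_sets functions cardinality.

Set Implicit Arguments.
Unset Strict Implicit.
Unset Printing Implicit Defensive.

Local Open Scope classical_set_scope.
Local Open Scope card_scope.

(* Finite 0-1 sequences, with false for 0 and true for 1. Length is [size],
   s restricted to m is [take m s], s(m) is [nth false s m], and initial
   segment is [prefix]. A notation, so that the structures of [seq] apply. *)
Notation node := (seq bool).

Definition meet (s t : node) : node :=
  take (\max_(m < (minn (size s) (size t)).+1 | take m s == take m t) m) s.

Definition lex_lt (s t : node) : Prop :=
  [/\ ~~ prefix s t, ~~ prefix t s
    & (nth false s (size (meet s t)) < nth false t (size (meet s t)))%N].

Definition is_tree (T : set node) : Prop :=
  exists L : set nat,
    (forall t, T t -> L (size t)) /\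
    (forall t l, T t -> L l -> (l < size t)%N -> T (take l t)).

(* [index] is the N <= omega of the definition, as an initial segment of nat;
   the values of [code] outside [index] are irrelevant. *)
Record coded_tree := CodedTree {
  nodes : set node;
  index : set nat;
  code : nat -> node;
  nodes_tree : is_tree nodes;
  index_initial : forall m n, (m < n)%N -> index n -> index m;
  code_nodes : forall n, index n -> nodes (code n);
  code_lt : forall m n, (m < n)%N -> index n -> (size (code m) < size (code n))%N
}.

Definition coding_nodes (T : coded_tree) : set node := code T @` index T.

Definition levels (T : coded_tree) : set nat :=
  [set size t | t in nodes T].

Record strong_similarity (S T : coded_tree) (f : node -> node) : Prop :=
  StrongSimilarity {
  ss_bij : set_bij (nodes S) (nodes T) f;
  ss_lex : forall s t, nodes S s -> nodes S t ->
    (lex_lt s t <-> lex_lt (f s) (f t));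
  ss_meet_sub : forall s t u v,
    nodes S s -> nodes S t -> nodes S u -> nodes S v ->
    prefix (meet s t) (meet u v) = prefix (meet (f s) (f t)) (meet (f u) (f v));
  ss_meet : forall s t, nodes S s -> nodes S t ->
    f (meet s t) = meet (f s) (f t);
  ss_meet_size : forall s t u v,
    nodes S s -> nodes S t -> nodes S u -> nodes S v ->
    (size (meet s t) < size (meet u v))%N =
    (size (meet (f s) (f t)) < size (meet (f u) (f v)))%N;
  ss_passing : forall s t, nodes S s -> nodes S t -> (size s < size t)%N ->
    nth false (f t) (size (f s)) = nth false t (size s);
  ss_coding : f @` coding_nodes S = coding_nodes T
}.

Definition rado_graph (E : rel nat) : Prop :=
  [/\ symmetric E, irreflexive E &
      forall U V : {fset nat}, [disjoint U & V]%fset ->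
      exists2 z, z \notin (U `|` V)%fset &
        (forall u, u \in U -> E z u) /\ (forall v, v \in V -> ~~ E z v)].

Definition rado_code (E : rel nat) (n : nat) : node := mkseq (E n) n.

Lemma full_is_tree : is_tree [set: node].
Proof. by exists setT. Qed.

Lemma rado_code_lt (E : rel nat) m n : (m < n)%N -> [set: nat] n ->
  (size (rado_code E m) < size (rado_code E n))%N.
Proof. by rewrite !size_mkseq. Qed.

Definition rado_tree (E : rel nat) : coded_tree :=
  @CodedTree [set: node] [set: nat] (rado_code E) full_is_tree
    (fun _ _ _ _ => I) (fun _ _ => I) (@rado_code_lt E).

(* The space of strong similarity images of [rado_tree E]. *)
Definition TR (E : rel nat) : set coded_tree :=
  [set T | index T = [set: nat] /\
    exists2 f : node -> node, strong_similarity (rado_tree E) T f &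
      forall n, code T n = f (code (rado_tree E) n)].

Definition subtree (S T : coded_tree) : Prop := nodes S `<=` nodes T.

Definition approx (k : nat) (T : coded_tree) : set node :=
  [set t | nodes T t /\ (size t < size (code T k))%N].

Definition AT_ (E : rel nat) (k : nat) : set (set node) := approx k @` TR E.

Definition AT (E : rel nat) : set (set node) := \bigcup_k AT_ E k.

Definition AT_in_ (E : rel nat) (k : nat) (T : coded_tree) : set (set node) :=
  [set A | AT_ E k A /\ A `<=` nodes T].

Definition AT_in (E : rel nat) (T : coded_tree) : set (set node) :=
  [set A | AT E A /\ A `<=` nodes T].

(* [A, T] *)
Definition basic (E : rel nat) (A : set node) (T : coded_tree) :
    set coded_tree :=
  [set S | [/\ TR E S, subtree S T & exists j, approx j S = A]].

(* l_A, for finite A; it is 0 when A is empty. *)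
Definition max_length (A : set node) : nat := \max_(t <- fset_set A) size t.

Definition max_nodes (A : set node) : set node :=
  [set t | A t /\ forall u, A u -> prefix t u -> u = t].

Definition restrict (A : set node) (l : nat) : set node :=
  [set t | A t /\ (size t < l)%N] `|`
  [set take l t | t in [set t | A t /\ (l <= size t)%N]].

Definition plus (A : set node) : set node :=
  A `|` [set t | exists2 s, max_nodes A s & exists i : bool, t = rcons s i].

Definition hatAT (E : rel nat) : set (set node) :=
  [set B | exists A l, [/\ AT E A, (l <= max_length A)%N & B = restrict A l]].

Definition hatAT_in (E : rel nat) (T : coded_tree) : set (set node) :=
  [set B | exists A l,
    [/\ AT_in E T A, levels T l, (l <= max_length A)%N & B = restrict A l]].

Definition end_extends (Y X : set node) : Prop :=
  exists2 g : node -> node, set_bij X Y g & forall x, X x -> prefix x (g x).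

Definition is_depth (E : rel nat) (B : set node) (m : nat) : Prop :=
  (exists2 C, AT_ E m C & end_extends (max_nodes C) (max_nodes B)) /\
  (forall m' C, AT_ E m' C -> end_extends (max_nodes C) (max_nodes B) ->
    (m <= m')%N).

(* [B, T]^* *)
Definition basic_star (E : rel nat) (B : set node) (T : coded_tree) :
    set coded_tree :=
  [set S | [/\ TR E S, subtree S T & exists2 m, is_depth E B m &
    end_extends (max_nodes (approx m S)) (max_nodes B)]].

(* r_j[B, T]^*, meant for j at least the m of [is_depth]. *)
Definition approx_star (E : rel nat) (j : nat) (B : set node)
    (T : coded_tree) : set (set node) :=
  approx j @` basic_star E B T.

(* Membership of B in [hatAT E] up to the nodes of B that are not maximal,
   which neither [basic_star] nor [approx_star] depends on. For B = A `|` Y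
   with exactly one successor in Y of each maximal node of A, membership on
   the nose is impossible: a member of [hatAT E] containing a node s and a
   proper extension of s contains proper extensions of s through both
   immediate successors of s. Requiring it would make that case vacuous. *)
Definition hatAT_max (E : rel nat) (B : set node) : Prop :=
  exists2 B', hatAT E B' & max_nodes B' = max_nodes B.

Definition case_a (E : rel nat) (T : coded_tree) (k : nat)
    (A B : set node) : Prop :=
  [/\ (1 <= k)%N, AT_in_ E k T A & B = plus A].

Definition case_b (k : nat) (A B : set node) : Prop :=
  [/\ A !=set0, max_nodes A #= `I_(2 ^ k) &
      exists Y : set node,
        [/\ Y `<=` max_nodes (plus A),
            (forall s, max_nodes A s -> exists! i : bool, Y (rcons s i)) &
            B = A `|` Y]].

(* Main.v *)
(* The members of [TR E] are exactly the infinite strong subtrees of the binary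
   tree, whatever [E] is. An element C of r_(k+1)[B, S]^* is the closure under
   meets of its top level, and this level consists of one node of S, all of the
   same length, above each node of max(B). A coloring of these C is thus a
   coloring of a level product, and the theorem is an instance of the strong
   tree version of the Halpern-Lauchli theorem, applied to the cones above the
   immediate successors of the top nodes of D. That theorem follows from the
   Carlson-Simpson theorem on left variable words, which is proved with an
   idempotent ultrafilter on words. *)
Require Import Defs.
From mathcomp Require Import all_boot finmap.
From mathcomp Require Import boolp classical_sets functions cardinality filter.
Set Implicit Arguments.
Unset Strict Implicit.
Unset Printing Implicit Defensive.

Local Open Scope classical_set_scope.
Local Open Scope card_scope.


(** * Ultrafilters and compactness of the Stone space *)

Definition ultras (T : Type) : set (set_system T) := [set u | UltraFilter u].

Lemma ultra_of_dichotomy (T : Type) (F : set_system T) : ProperFilter F ->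
  (forall P, F P \/ F (~` P)) -> UltraFilter F.
Proof.
move=> FF FP; split=> // G GF FG; apply/seteqP; split=> // P GP.
have [//|/FG GnP] := FP P; exfalso.
by apply: (@filter_not_empty _ G); rewrite -(setICr P); apply: filterI.
Qed.

Lemma ultra_setC (T : Type) (u : set_system T) (P : set T) :
  UltraFilter u -> ~ u P -> u (~` P).
Proof. by move=> /(@in_ultra_setVsetC _ _ P)[]. Qed.

Lemma ultra_eq (T : Type) (u v : set_system T) :
  UltraFilter u -> UltraFilter v -> u `<=` v -> u = v.
Proof. by move=> uU vU uv; rewrite (@max_filter _ _ uU v). Qed.

(* The closed subsets of the Stone space of ultrafilters on [T]. *)
Definition uclosed (T : Type) (K : set (set_system T)) : Prop :=
  K `<=` @ultras T /\
  forall u, UltraFilter u -> (forall P, (forall v, K v -> v P) -> u P) -> K u.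

Lemma uclosed_bigcap (T : Type) (F : set (set (set_system T))) :
  F !=set0 -> F `<=` @uclosed T -> uclosed (\bigcap_(K in F) K).
Proof.
move=> [K0 FK0] Fc; split=> [u /(_ _ FK0)|u uU uP K FK].
  by have [sub _] := Fc _ FK0; exact: sub.
have [_] := Fc _ FK; apply=> // P KP; apply: uP => v vF.
exact: (KP _ (vF _ FK)).
Qed.

(** Compactness: the sets that belong to every ultrafilter of some member of the chain form a proper
    filter, and an ultrafilter refining it lies in each member, as that member is closed. *)
Lemma chain_bigcap_nonempty (T : Type) (F : set (set (set_system T))) :
  F !=set0 -> total_on F subset -> F `<=` @uclosed T ->
  (forall K, F K -> K !=set0) -> \bigcap_(K in F) K !=set0.
Proof.
move=> [K0 FK0] Ftot Fc F0.
pose G : set_system T := [set P | exists2 K, F K & forall v, K v -> v P].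
have [] := @ultraFilterLemma _ G.
  apply: Build_ProperFilter_ex => [P [K FK KP]|].
    have [v Kv] := F0 _ FK; have [sub _] := Fc _ FK.
    have vU : UltraFilter v := sub _ Kv.
    exact: (filter_ex (KP _ Kv)).
  split.
  - exists K0 => // v K0v; have [sub _] := Fc _ FK0.
    have vU : UltraFilter v := sub _ K0v; exact: filterT.
  - move=> P Q [K FK KP] [L FL LQ].
    have [KL|LK] := Ftot _ _ FK FL.
    + exists K => // v Kv; have vU : UltraFilter v := (Fc _ FK).1 _ Kv.
      by apply: filterI; [exact: KP|exact: (LQ _ (KL _ Kv))].
    + exists L => // v Kv; have vU : UltraFilter v := (Fc _ FL).1 _ Kv.
      by apply: filterI; [exact: (KP _ (LK _ Kv))|exact: LQ].
  - move=> P Q PQ [K FK KP]; exists K => // v Kv.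
    have vU : UltraFilter v := (Fc _ FK).1 _ Kv.
    by apply: filterS PQ _; exact: KP.
move=> u [uU Gu]; exists u => K FK.
by have [_] := Fc _ FK; apply=> // P KP; apply: Gu; exists K.
Qed.

(** [Q] will be closure under products or under left multiplication. [Zorn_bigcup] yields a maximal
    set, so it is applied to the sets removed from [K0]. *)
Lemma minimal_uclosed (T : Type) (Q : set (set (set_system T)))
    (K0 : set (set_system T)) :
  (forall F, F !=set0 -> F `<=` Q -> Q (\bigcap_(K in F) K)) ->
  uclosed K0 -> K0 !=set0 -> Q K0 ->
  exists K, [/\ K `<=` K0, uclosed K, K !=set0, Q K &
    forall L, L `<=` K -> uclosed L -> L !=set0 -> Q L -> L = K].
Proof.
move=> Qcap K0c K00 QK0.
pose P := [set X | [/\ uclosed (K0 `\` X), K0 `\` X !=set0 & Q (K0 `\` X)]].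
have [F FP Ftot|X [[Xc X0 QX] Xmax]] := @Zorn_bigcup _ P.
  have [->|/set0P[X0 FX0]] := eqVneq F set0.
    by rewrite /P /= bigcup_set0 setD0.
  pose G := [set K0 `\` X | X in F].
  have -> : P (\bigcup_(X in F) X) = [/\ uclosed (\bigcap_(K in G) K),
      \bigcap_(K in G) K !=set0 & Q (\bigcap_(K in G) K)].
    have -> : \bigcap_(K in G) K = K0 `\` \bigcup_(X in F) X.
      rewrite bigcap_image; apply/seteqP; split=> u.
        move=> uF; split=> [|[X FX Xu]]; first by case: (uF _ FX0).
        by case: (uF _ FX).
      by move=> [K0u nu] X FX; split=> // Xu; apply: nu; exists X.
    by [].
  have G0 : G !=set0 by exists (K0 `\` X0), X0.
  have Gc : G `<=` @uclosed T by move=> _ [X FX <-]; case: (FP _ FX).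
  split; first exact: uclosed_bigcap.
    apply: chain_bigcap_nonempty => // [_ _ [X FX <-] [Y FY <-]|_ [X FX <-]];
      last by case: (FP _ FX).
    by have [XY|YX] := Ftot _ _ FX FY; [right|left]; exact: setDS.
  by apply: Qcap => // _ [X FX <-]; case: (FP _ FX).
exists (K0 `\` X); split=> // L LX Lc L0 QL.
have LK0 : K0 `\` ~` L = L by rewrite setDE setCK setIidr// => u /LX[].
apply/seteqP; split=> // u Xu; apply: contrapT => nLu.
apply: (Xmax (~` L)); last by rewrite /P /= LK0.
rewrite properEneq; split; last by move=> v Xv /LX[].
by apply/eqP => XL; case: Xu => _; rewrite XL.
Qed.

(** * Products of ultrafilters and idempotents *)

(** The extension of [op] to the Stone-Cech compactification; with this order of quantifiers the
    product is continuous in its left factor [p]. *)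
Definition uprod (T : Type) (op : T -> T -> T) (p q : set_system T) :
    set_system T :=
  [set P | p [set u | q [set v | P (op u v)]]].

Lemma uprodA (T : Type) (op : T -> T -> T) :
  associative op -> associative (uprod op).
Proof.
move=> opA p q r; rewrite funeqE => P; congr (p _); rewrite funeqE => u.
congr (q _); rewrite funeqE => v; congr (r _); rewrite funeqE => w /=.
by rewrite opA.
Qed.

Lemma uprod_ultra (T : Type) (op : T -> T -> T) (p q : set_system T) :
  UltraFilter p -> UltraFilter q -> UltraFilter (uprod op p q).
Proof.
move=> pU qU; have pqF : ProperFilter (uprod op p q).
  apply: Build_ProperFilter_ex.
    move=> P Pp; have [u Pu] := @filter_ex _ p _ _ Pp.
    have [v Puv] := @filter_ex _ q _ _ Pu.
    by exists (op u v).
  split.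
  - by apply: (@filterE _ p) => u; apply: (@filterE _ q).
  - by move=> P Q; apply: (@filterS2 _ p) => u; exact: (@filterI _ q).
  - move=> P Q PQ; apply: (@filterS _ p) => u.
    by apply: (@filterS _ q) => v; exact: PQ.
apply: ultra_of_dichotomy => P.
have [|nP] := pselect (uprod op p q P); first by left.
right; apply: (@filterS _ p) (ultra_setC pU nP) => u /(ultra_setC qU).
exact: (@filterS _ q).
Qed.

Lemma fmap_ultra (T U : Type) (f : T -> U) (p : set_system T) :
  UltraFilter p -> UltraFilter (fmap f p).
Proof.
move=> pU; apply: ultra_of_dichotomy => P.
have [|nP] := pselect (p (f @^-1` P)); first by left.
by right; exact: (@ultra_setC _ p).
Qed.

Lemma uprod_fmap (T : Type) (op : T -> T -> T) (f : T -> T)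
    (p q : set_system T) :
  {morph f : x y / op x y} ->
  fmap f (uprod op p q) = uprod op (fmap f p) (fmap f q).
Proof.
move=> fM; rewrite funeqE => P; congr (p _); rewrite funeqE => u.
by congr (q _); rewrite funeqE => v; rewrite /= fM.
Qed.

Lemma uprod_mem (T : Type) (op : T -> T -> T) (A B C : set T)
    (p q : set_system T) :
  UltraFilter p -> UltraFilter q -> (forall x y, A x -> B y -> C (op x y)) ->
  p A -> q B -> uprod op p q C.
Proof.
move=> pU qU ABC pA qB.
apply: (@filterS _ p) pA => u Au; apply: (@filterS _ q) qB => v.
exact: ABC.
Qed.

Lemma fmap_id_on (T : Type) (f : T -> T) (A : set T) (p : set_system T) :
  UltraFilter p -> p A -> (forall x, A x -> f x = x) -> fmap f p = p.
Proof.
move=> pU pA fA; apply/esym/ultra_eq; first exact: fmap_ultra.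
move=> P pP; apply: (@filterS _ p) (filterI pA pP) => x [Ax Px].
by rewrite /preimage /= fA.
Qed.

(* Right multiplication is continuous and the space is compact. *)
Lemma uclosed_uprodr (T : Type) (op : T -> T -> T) (K : set (set_system T))
    (q : set_system T) :
  uclosed K -> UltraFilter q -> uclosed [set uprod op p q | p in K].
Proof.
move=> [KU Kc] qU; split=> [_ [p /KU pU <-]|u uU uP].
  exact: uprod_ultra.
(* An ultrafilter [p] refining the sets [B PG] contains every [G] common to all of [K], hence lies
   in [K], and its product with [q] contains every [P] in [u]. *)
pose D := [set PG : set T * set T | u PG.1 /\ forall v, K v -> v PG.2].
pose B (PG : set T * set T) := [set x | q [set y | PG.1 (op x y)]] `&` PG.2.
have [] := @ultraFilterLemma _ (filter_from D B).
  apply: filter_from_proper => [|[P G] [/= uPP KG]].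
    apply: filter_from_filter => [|[P G] [P' G'] [/= uPP KG] [/= uP' KG']].
      exists (setT, setT); split=> [|v Kv]; first exact: filterT.
      by have vU : UltraFilter v := KU _ Kv; exact: filterT.
    exists (P `&` P', G `&` G').
      split=> [|v Kv] /=; first exact: filterI.
      have vU : UltraFilter v := KU _ Kv.
      by apply: filterI; [exact: KG|exact: KG'].
    move=> x [/= qx [Gx G'x]]; split; split=> //=;
      by apply: filterS qx => y [].
  apply: contrapT => nB; have : u (~` P).
    apply: uP => _ [p Kp <-]; have pU : UltraFilter p := KU _ Kp.
    apply: filterS (KG _ Kp) => x Gx /=.
    apply: filterS (_ : q (~` [set y | P (op x y)])) => //.
    by apply: ultra_setC => qx; apply: nB; exists x.
  by move=> uCP; have [x []] := filter_ex (filterI uPP uCP).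
move=> p [pU Bp]; exists p.
  apply: Kc => // G KG; apply: Bp; exists (setT, G) => [|x []//].
  by split=> //=; exact: filterT.
apply/esym/ultra_eq => //; first exact: uprod_ultra.
move=> P uPP; apply: Bp; exists (P, setT) => [|x []//].
by split=> //= v Kv; have vU : UltraFilter v := KU _ Kv; exact: filterT.
Qed.

Lemma uclosed_fixr (T : Type) (op : T -> T -> T) (K : set (set_system T))
    (q r : set_system T) :
  uclosed K -> UltraFilter q -> UltraFilter r ->
  uclosed (K `&` [set p | uprod op p q = r]).
Proof.
move=> [KU Kc] qU rU; split=> [p [/KU]//|u uU uP].
have Ku : K u by apply: Kc => // P KP; apply: uP => v [/KP].
split=> //; apply/esym/ultra_eq => //; first exact: uprod_ultra.
by move=> P rP; apply: uP => v [_ vr]; rewrite -vr in rP.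
Qed.

Lemma uclosed_mem (T : Type) (A : set T) :
  uclosed [set u | UltraFilter u /\ u A].
Proof.
split=> [u []//|u uU uP]; split=> //.
by apply: uP => v [].
Qed.

(** For [r] in a minimal closed subsemigroup [K], the products of [K] with [r] form a closed
    subsemigroup, hence all of [K], so some [p] in [K] satisfies [uprod op p r = r]. Such [p] form a
    closed subsemigroup too, hence all of [K], and [r] is one of them. *)
Lemma ellis_numakura (T : Type) (op : T -> T -> T) (R : set (set_system T)) :
  associative op -> uclosed R -> R !=set0 ->
  (forall p q, R p -> R q -> R (uprod op p q)) ->
  exists2 r, R r & uprod op r r = r.
Proof.
move=> opA Rc R0 Rm.
have [|K [KR Kc [r Kr] Km Kmin]] := minimal_uclosed
    (Q := [set K | forall p q, K p -> K q -> K (uprod op p q)]) _ Rc R0 Rm.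
  move=> F _ FQ p q pF qF K FK; apply: (FQ _ FK); [exact: pF|exact: qF].
have KU := Kc.1.
have rU : UltraFilter r := KU _ Kr.
have Krr : [set uprod op p r | p in K] = K.
  apply: Kmin.
  - by move=> _ [p Kp <-]; exact: Km.
  - exact: uclosed_uprodr.
  - by exists (uprod op r r), r.
  - move=> _ _ [p Kp <-] [q Kq <-]; exists (uprod op (uprod op p r) q).
      by apply: (Km _ _ _ Kq); exact: Km.
    by rewrite !uprodA.
have [s Ks sr] : [set uprod op p r | p in K] r by rewrite Krr.
have Kfix : K `&` [set p | uprod op p r = r] = K.
  apply: Kmin.
  - by move=> p [].
  - exact: uclosed_fixr.
  - by exists s.
  - move=> p q [Kp pr] [Kq qr]; split; first exact: Km.
    by rewrite /= -uprodA// qr.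
exists r; first exact: KR.
by have [] : (K `&` [set p | uprod op p r = r]) r by rewrite Kfix.
Qed.

(* With [L] a minimal closed left ideal of ultrafilters on [A] and [p] in [L],
   an idempotent [r] in (ultrafilters on [V]) * [p] has all its retractions
   [f i r] idempotent in [L], hence right identities of [L]. *)
Lemma exists_absorbing_ultrafilters (T I : Type) (op : T -> T -> T)
    (A V : set T) (f : I -> T -> T) :
  associative op -> A !=set0 -> V !=set0 ->
  (forall x y, A x -> A y -> A (op x y)) -> (forall x y, V x -> V (op x y)) ->
  (forall i, {morph f i : x y / op x y}) -> (forall i x, A (f i x)) ->
  (forall i x, A x -> f i x = x) ->
  exists p r : set_system T, [/\ UltraFilter p, UltraFilter r, r V &
    forall i, uprod op p (fmap (f i) r) = p /\ uprod op r (fmap (f i) r) = r].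
Proof.
move=> opA [a0 Aa0] [v0 Vv0] AM VM fM fA fid.
pose bA := [set u : set_system T | UltraFilter u /\ u A].
pose bV := [set u : set_system T | UltraFilter u /\ u V].
have bA0 : bA !=set0.
  exists (principal_filter a0); split; first exact: principal_filter_ultra.
  exact/principal_filterP.
have bV0 : bV !=set0.
  exists (principal_filter v0); split; first exact: principal_filter_ultra.
  exact/principal_filterP.
have bAM p q : bA p -> bA q -> bA (uprod op p q).
  move=> [pU pA] [qU qA]; split; first exact: uprod_ultra.
  exact: uprod_mem pA qA.
have [|L [LA Lc [p Lp] LM Lmin]] := minimal_uclosed
    (Q := [set K | forall p q, bA p -> K q -> K (uprod op p q)])
    _ (uclosed_mem A) bA0 bAM.
  by move=> F _ FQ p q bAp qF K FK; apply: (FQ _ FK) => //; exact: qF.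
have [pU pA] := LA _ Lp.
pose R := [set uprod op s p | s in bV].
have Rc : uclosed R by apply: uclosed_uprodr => //; exact: uclosed_mem.
have R0 : R !=set0 by have [s sV] := bV0; exists (uprod op s p), s.
(* [R] is closed under products: (s p)(t p) = ((s p) t) p, and (s p) t concentrates on [V] because
   [s] does. *)
have [_ _ [s [sU sV] <-] [t [tU tV] <-]|r [s [sU sV] sr] rr] :=
  ellis_numakura opA Rc R0.
  have spU : UltraFilter (uprod op s p) by exact: uprod_ultra.
  exists (uprod op (uprod op s p) t); last by rewrite !uprodA.
  split; first exact: uprod_ultra.
  rewrite -uprodA//; apply: (@uprod_mem _ _ V setT) => //.
  - exact: uprod_ultra.
  - by move=> x y Vx _; exact: VM.
  - by have ptU := uprod_ultra op pU tU; exact: filterT.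
have rU : UltraFilter r by rewrite -sr; exact: uprod_ultra.
have e i q : L q -> uprod op q (fmap (f i) r) = q.
  have eU := fmap_ultra (f i) rU.
  have ee : uprod op (fmap (f i) r) (fmap (f i) r) = fmap (f i) r.
    by rewrite -uprod_fmap// rr.
  (* As [f i] fixes [p], the image of [r] is the image of [s], which concentrates on [A], times
     [p]. *)
  have Le : L (fmap (f i) r).
    rewrite -sr uprod_fmap// (fmap_id_on pU pA)//; last exact: fid.
    apply: LM => //; split; first exact: fmap_ultra.
    by apply: (@filterE _ s) => x; exact: fA.
  have <- : [set uprod op q (fmap (f i) r) | q in bA] = L.
    apply: Lmin.
    - by move=> _ [t bAt <-]; exact: LM.
    - by apply: uclosed_uprodr => //; exact: uclosed_mem.
    - by exists (uprod op p (fmap (f i) r)), p.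
    - move=> t _ bAt [t' bAt' <-]; exists (uprod op t t'); first exact: bAM.
      by rewrite uprodA.
  by move=> [t _ <-]; rewrite -uprodA// ee.
exists p, r; split=> //.
  rewrite -sr; apply: (@uprod_mem _ _ V setT) => //; last exact: filterT.
  by move=> x y Vx _; exact: VM.
by move=> i; split; [exact: e|rewrite -sr -uprodA// sr e].
Qed.

(** * The Carlson-Simpson theorem *)

(* The left variable word [None :: u] with its variable [None] set to [a]. *)
Definition inst (A : Type) (a : A) (u : seq (option A)) : seq A :=
  a :: map (odflt a) u.

Fixpoint insts (A : Type) (u : nat -> seq (option A)) (s : seq A) : seq A :=
  if s is a :: s' then inst a (u 0) ++ insts (u \o succn) s' else [::].

(** [p] provides the initial word [w]; since [r] absorbs its own instances, the variable words can
    then be chosen one after another. *)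
Lemma carlson_simpson (A : finType) (c : seq A -> bool) :
  exists (w : seq A) (u : nat -> seq (option A)) (b : bool),
    forall s, c (w ++ insts u s) = b.
Proof.
pose f (a : A) (v : seq (option A)) := map (Some \o odflt a) v.
pose V : set (seq (option A)) := [set v | ohead v = Some None].
pose W : set (seq (option A)) := [set v | all isSome v].
have fM a : {morph f a : x y / x ++ y} by move=> x y; rewrite /f map_cat.
have fSome a (s : seq A) : f a (map Some s) = map Some s.
  by rewrite /f -map_comp.
have fW a v : W v -> f a v = v by elim: v => //= -[x|//] v IH /= /IH{2}<-.
have finst a v : V v -> f a v = map Some (inst a (behead v)).
  by case: v => [|[|] v]//= _; rewrite /f /inst/= -map_comp.
have [] := @exists_absorbing_ultrafilters (seq (option A)) A cat W V f => //.
- exact: catA.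
- by exists [::].
- by exists [:: None].
- by move=> x y; rewrite /W/= all_cat => -> ->.
- by case.
- by move=> a v; rewrite /W /f/= all_map; apply/allP => x.
move=> p [r [pU rU rV pr]].
(* Finiteness of [A] lets the same [x] and the same large set of [v] serve all letters at once. *)
have step q P : UltraFilter q -> (forall a, uprod cat q (fmap (f a) r) = q) ->
    q P -> q [set x | r [set v | forall a, P (x ++ f a v)]].
  move=> qU qr qP; have : q [set x | forall a, r [set v | P (x ++ f a v)]].
    by apply: filter_forall => a; rewrite -(qr a) in qP.
  by apply: (@filterS _ q) => x xP; exact: filter_forall.
have /choice[g gP] (Q : set (seq (option A))) : exists x, r Q ->
    [/\ Q x, V x & r [set v | forall a, Q (x ++ f a v)]].
  have [rQ|] := pselect (r Q); last by exists [::].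
  have rr := step _ _ rU (fun a => (pr a).2) rQ.
  have [x [[Qx Vx] xQ]] := filter_ex (filterI (filterI rQ rV) rr).
  by exists x.
(* The continuations of [g Q] all of whose instances stay in [Q]. This set is again in [r], so the
   choice can be iterated. *)
pose next Q := [set v | forall a, Q (g Q ++ f a v)] : set (seq (option A)).
pose u Q n := behead (g (iter n next Q)).
have uS Q : u Q \o succn = u (next Q).
  by apply/funext => n; rewrite /u/= -iterS iterSr.
have rnext Q : r Q -> r (next Q) by move=> /gP[].
(* The first word [g Q] keeps its variable; the induction step substitutes a letter into the first
   word of [next Q]. *)
have Qg s : forall Q, r Q -> Q (g Q ++ map Some (insts (u Q \o succn) s)).
  elim: s => [|a s IH] Q rQ; first by rewrite cats0; have [] := gP _ rQ.
  have [_ Vg _] := gP _ (rnext _ rQ).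
  have := IH _ (rnext _ rQ) a.
  by rewrite fM fSome (finst _ _ Vg) (uS Q) map_cat.
(* Words with variables are colored by erasing the variables; the word [x] found below may contain
   some. *)
pose P b : set (seq (option A)) := [set v | c (pmap id v) = b].
have [b pPb] : exists b, p (P b).
  have [pP|nP] := pselect (p (P true)); first by exists true.
  exists false; apply: filterS (ultra_setC pU nP) => v.
  by rewrite /P/=; case: (c _).
have pp := step _ _ pU (fun a => (pr a).1) pPb.
have [x [Px rx]] := filter_ex (filterI pPb pp).
exists (pmap id x), (u [set v | forall a, P b (x ++ f a v)]), b.
move=> -[|a s]; first by rewrite cats0.
have [_ Vg _] := gP _ rx; have := Qg s _ rx a.
by rewrite fM fSome (finst _ _ Vg) -map_cat /P/mkset pmap_cat map_pK.
Qed.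

(** * Meets and initial segments of binary words *)

Lemma meet_max (s t : node) m :
  (m <= minn (size s) (size t))%N -> take m s = take m t ->
  (forall m', (m' <= minn (size s) (size t))%N -> take m' s = take m' t ->
    (m' <= m)%N) ->
  meet s t = take m s.
Proof.
move=> le_m st max_m; rewrite /meet; congr take; apply/eqP; rewrite eqn_leq.
apply/andP; split.
  apply/bigmax_leqP => i /eqP sti; apply: max_m sti.
  by rewrite -ltnS.
have lt_m : (m < (minn (size s) (size t)).+1)%N by rewrite ltnS.
by apply: (@leq_bigmax_cond _ _ _ (Ordinal lt_m)); rewrite /= st.
Qed.

Lemma meet_prefix (s t : node) : prefix s t -> meet s t = s.
Proof.
move=> /prefixP[u ->]; rewrite (@meet_max _ _ (size s)) ?take_size//.
- by rewrite size_cat (minn_idPl (leq_addr _ _)).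
- by rewrite take_size_cat.
- by move=> m' le_m' _; apply: leq_trans le_m' (geq_minl _ _).
Qed.

Lemma meet_branch (p s t : node) i :
  meet (p ++ i :: s) (p ++ ~~ i :: t) = p.
Proof.
rewrite (@meet_max _ _ (size p)) ?take_size_cat//.
  by rewrite !size_cat leq_min !leq_addr.
move=> m le_m; rewrite !take_cat; case: ltnP => [/ltnW//|le_pm].
case E : (m - size p)%N => [|k]; first by move/eqP: E; rewrite subn_eq0.
by move/eqP; rewrite eqseq_cat//= eqseq_cons eqxx; case: (i).
Qed.

Lemma meetC (s t : node) : meet s t = meet t s.
Proof.
rewrite /meet minnC.
under eq_bigl => m do rewrite eq_sym.
set m := \max_(_ < _ | _) _.
suff /eqP : take m t == take m s by [].
rewrite /m.
elim/big_ind : _ => [|a b ta tb|i //]; first by rewrite !take0.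
by case: (leqP a b).
Qed.

Lemma meet_prefixl (s t : node) : prefix (meet s t) s.
Proof. exact: prefix_take. Qed.

Lemma node_comparison (s t : node) :
  [\/ prefix s t, prefix t s |
    exists p i s' t', s = p ++ i :: s' /\ t = p ++ ~~ i :: t'].
Proof.
elim: s t => [|x s IH] [|y t]; rewrite ?prefix0s; try by constructor.
have [->|nxy] := eqVneq x y; last first.
  apply: Or33; exists [::], x, s, t; split=> //=.
  by case: x y nxy => [] [].
have [st|ts|[p [i [s' [t' [-> ->]]]]]] := IH t.
- by apply: Or31; rewrite prefix_cons eqxx.
- by apply: Or32; rewrite prefix_cons eqxx.
- by apply: Or33; exists (y :: p), i, s', t'.
Qed.

Lemma prefix_size (s t : node) : prefix s t -> (size s <= size t)%N.
Proof. by move=> /prefixP[u ->]; rewrite size_cat leq_addr. Qed.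

Lemma prefix_anti (s t : node) : prefix s t -> (size t <= size s)%N -> s = t.
Proof.
move=> /prefixP[u ->]; rewrite size_cat -[leqRHS]addn0 leq_add2l leqn0.
by move=> /nilP ->; rewrite cats0.
Qed.

Lemma prefix_comparable (s t u : node) :
  prefix s u -> prefix t u -> (size s <= size t)%N -> prefix s t.
Proof.
rewrite !prefixE => /eqP su /eqP tu le_st.
by rewrite -tu take_takel// su.
Qed.

Lemma prefix_rconsP (s t : node) : prefix s t -> s <> t ->
  exists i, prefix (rcons s i) t.
Proof.
move=> /prefixP[[|i u] ->]; first by rewrite cats0.
by move=> _; exists i; rewrite -cat_rcons prefix_prefix.
Qed.

Lemma prefix_rcons_nth (s t : node) i :
  prefix (rcons s i) t -> nth false t (size s) = i.
Proof.
by move=> /prefixP[u ->]; rewrite cat_rcons nth_cat ltnn subnn.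
Qed.

(** * Strong embeddings and strong similarity images *)

(* The maps whose images are the infinite strong subtrees of the binary tree. *)
Definition strong_embedding (f : node -> node) : Prop :=
  (forall s i, prefix (rcons (f s) i) (f (rcons s i))) /\
  (forall s t, size s = size t -> size (f s) = size (f t)).

Lemma emb_prefix f (s t : node) : strong_embedding f ->
  prefix s t -> prefix (f s) (f t).
Proof.
move=> [fr _] /prefixP[u ->]; elim/last_ind: u => [|u i IH].
  by rewrite cats0 prefix_refl.
rewrite -rcons_cat; apply: prefix_trans IH _.
by apply: prefix_trans (fr _ _); rewrite prefix_rcons.
Qed.

Lemma emb_rcons f (s t : node) i : strong_embedding f ->
  prefix (rcons s i) t -> prefix (rcons (f s) i) (f t).
Proof.
by move=> fe st; apply: prefix_trans (fe.1 s i) _; exact: emb_prefix.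
Qed.

Lemma emb_size f (s t : node) : strong_embedding f ->
  (size (f s) < size (f t))%N = (size s < size t)%N.
Proof.
move=> fe; have lt u v : (size u < size v)%N -> (size (f u) < size (f v))%N.
  move=> uv; have le_uv := ltnW uv.
  have su : size (take (size u) v) = size u by rewrite size_takel.
  rewrite -(fe.2 _ _ su).
  have [i uiv] : exists i, prefix (rcons (take (size u) v) i) v.
    apply: prefix_rconsP; first by rewrite prefixE su.
    by move=> vE; rewrite -su vE ltnn in uv.
  by have := prefix_size (emb_rcons fe uiv); rewrite size_rcons.
have [/lt//|] := ltnP (size s) (size t).
rewrite leq_eqVlt => /orP[/eqP/fe.2->|/lt]; first by rewrite ltnn.
by move=> /ltnW; rewrite leqNgt => /negbTE.
Qed.

Lemma emb_size_eq f (s t : node) : strong_embedding f ->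
  size (f s) = size (f t) -> size s = size t.
Proof.
move=> fe st; apply/eqP; rewrite eqn_leq !(leqNgt (size _)).
rewrite -(emb_size s t fe) -(emb_size t s fe) st.
by rewrite ltnn.
Qed.

Lemma emb_branch f (p s t : node) i : strong_embedding f ->
  exists s' t', f (p ++ i :: s) = f p ++ i :: s' /\
                f (p ++ ~~ i :: t) = f p ++ ~~ i :: t'.
Proof.
move=> fe.
have ext j u : exists u', f (p ++ j :: u) = f p ++ j :: u'.
  have /prefixP[u' ->] : prefix (rcons (f p) j) (f (p ++ j :: u)).
    by apply: emb_rcons => //; rewrite -cat_rcons prefix_prefix.
  by exists u'; rewrite cat_rcons.
by have [s' ->] := ext i s; have [t' ->] := ext (~~ i) t; exists s', t'.
Qed.

Lemma prefix_branch (p s t : node) i :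
  prefix (p ++ i :: s) (p ++ ~~ i :: t) = false.
Proof. by rewrite prefix_catr// eqxx prefix_cons; case: (i). Qed.

Lemma emb_prefixE f (s t : node) : strong_embedding f ->
  prefix (f s) (f t) = prefix s t.
Proof.
move=> fe; have [st|ts|[p [i [s' [t' [-> ->]]]]]] := node_comparison s t.
- by rewrite st emb_prefix.
- apply/idP/idP => [/prefix_size|]; last exact: emb_prefix.
  rewrite leqNgt emb_size// -leqNgt => le_st.
  by rewrite (prefix_anti ts le_st) prefix_refl.
- have [u [v [-> ->]]] := emb_branch p s' t' i fe.
  by rewrite !prefix_branch.
Qed.

Lemma emb_inj f : strong_embedding f -> injective f.
Proof.
move=> fe s t st; apply: prefix_anti.
  by rewrite -(emb_prefixE s t fe) st prefix_refl.
by rewrite leqNgt -(emb_size s t fe) st ltnn.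
Qed.

Lemma emb_meet f (s t : node) : strong_embedding f ->
  f (meet s t) = meet (f s) (f t).
Proof.
move=> fe; have [st|ts|[p [i [s' [t' [-> ->]]]]]] := node_comparison s t.
- by rewrite !meet_prefix// emb_prefix.
- by rewrite meetC (meetC (f s)) !meet_prefix// emb_prefix.
- have [u [v [-> ->]]] := emb_branch p s' t' i fe.
  by rewrite !meet_branch.
Qed.

Lemma emb_take f (s t : node) : strong_embedding f ->
  (size s < size t)%N -> take (size (f s)) (f t) = f (take (size s) t).
Proof.
move=> fe st; have su : size (take (size s) t) = size s.
  by rewrite size_takel// ltnW.
have : prefix (f (take (size s) t)) (f t).
  by apply: emb_prefix => //; rewrite prefixE su.
by rewrite prefixE (fe.2 _ _ su) => /eqP.
Qed.

Lemma emb_nth f (s t : node) : strong_embedding f ->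
  (size s < size t)%N -> nth false (f t) (size (f s)) = nth false t (size s).
Proof.
move=> fe st; have su : size (take (size s) t) = size s.
  by rewrite size_takel// ltnW.
have [i ui] : exists i, prefix (rcons (take (size s) t) i) t.
  apply: prefix_rconsP; first by rewrite prefixE su.
  by move=> vE; rewrite -su vE ltnn in st.
rewrite -(fe.2 _ _ su) (prefix_rcons_nth (emb_rcons fe ui)).
by rewrite -su (prefix_rcons_nth ui).
Qed.

Lemma emb_comp f g : strong_embedding f -> strong_embedding g ->
  strong_embedding (f \o g).
Proof.
move=> fe ge; split=> [s i|s t st] /=; last exact/fe.2/ge.2.
exact/emb_rcons/ge.1.
Qed.

Lemma range_emb_is_tree f : strong_embedding f -> is_tree (range f).
Proof.
move=> fe; exists [set size (f s) | s in [set: node]].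
split=> [_ [s _ <-]|_ _ [t _ <-] [s _ <-]]; first by exists s.
rewrite emb_size// => st; rewrite emb_take//; exact: imageP.
Qed.

Lemma emb_code_lt (E : rel nat) f m n : strong_embedding f -> (m < n)%N ->
  [set: nat] n -> (size (f (rado_code E m)) < size (f (rado_code E n)))%N.
Proof. by move=> fe mn _; rewrite emb_size// rado_code_lt. Qed.

Definition emb_tree (E : rel nat) f (fe : strong_embedding f) : coded_tree :=
  @CodedTree (range f) [set: nat] (f \o rado_code E) (range_emb_is_tree fe)
    (fun _ _ _ _ => I) (fun n _ => imageP f I)
    (fun m n mn nN => emb_code_lt E fe mn nN).

Lemma emb_tree_TR (E : rel nat) f (fe : strong_embedding f) :
  TR E (emb_tree E fe).
Proof.
split=> //; exists f => //; split.
- split=> [s _|s t _ _|s //]; [exact: imageP|exact: emb_inj].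
- move=> s t _ _; rewrite /lex_lt !emb_prefixE// -emb_meet//.
  have szm u v : ~~ prefix u v -> (size (meet u v) < size u)%N.
    have [uv|vu|[p [i [u' [v' [-> ->]]]]]] := node_comparison u v.
    + by rewrite uv.
    + rewrite meetC meet_prefix// => nuv; rewrite ltnNge; apply/negP => le_uv.
      by rewrite (prefix_anti vu le_uv) prefix_refl in nuv.
    + by rewrite meet_branch size_cat /= addnS ltnS leq_addr.
  have szm2 : ~~ prefix t s -> (size (meet s t) < size t)%N.
    by rewrite meetC; exact: szm.
  by split=> -[nst nts lt_st]; split=> //; move: lt_st;
    rewrite !emb_nth ?szm ?szm2.
- by move=> s t u v _ _ _ _; rewrite -!emb_meet// emb_prefixE.
- by move=> s t _ _; exact: emb_meet.
- by move=> s t u v _ _ _ _; rewrite -!emb_meet// emb_size.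
- by move=> s t _ _; exact: emb_nth.
- by rewrite /coding_nodes /= image_comp.
Qed.

(** The meet clause makes [f s] an initial segment of [f (rcons s i)], the length clause, read on
    meets of a node with itself, makes it a proper one, and the passing clause shows that the next
    digit is [i]. *)
Lemma TR_emb (E : rel nat) T : TR E T -> exists f, [/\ strong_embedding f,
  nodes T = range f & forall n s, size s = n -> size (code T n) = size (f s)].
Proof.
move=> [_ [f [[fT finj fsurj] _ _ fm fsz fp _] fc]]; exists f.
have meetss s : meet s s = s by rewrite meet_prefix ?prefix_refl.
have lt s t : (size s < size t)%N = (size (f s) < size (f t))%N.
  by have := fsz s s t t I I I I; rewrite !meetss.
have eqs s t : size s = size t -> size (f s) = size (f t).
  by move=> st; apply/eqP; rewrite eqn_leq !(leqNgt (size _)) -!lt st ltnn.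
split.
- split=> // s i; have ps : prefix (f s) (f (rcons s i)).
    have := fm s (rcons s i) I I; rewrite meet_prefix ?prefix_rcons// => ->.
    by rewrite meetC; exact: meet_prefixl.
  have [j pj] : exists j, prefix (rcons (f s) j) (f (rcons s i)).
    apply: prefix_rconsP => // /(congr1 size) e.
    by have := lt s (rcons s i); rewrite size_rcons ltnS leqnn -e ltnn.
  suff ji : j = i by rewrite -{1}ji.
  rewrite -(prefix_rcons_nth pj) fp ?size_rcons//.
  by rewrite nth_rcons ltnn eqxx.
- apply/seteqP; split=> [t /fsurj[s _ <-]|_ [s _ <-]]; first exact: imageP.
  exact: (fT s I).
- by move=> n s sn; rewrite fc; apply: eqs; rewrite /= size_mkseq.
Qed.

(** * The Halpern-Lauchli theorem *)

Lemma map_insts (A B : Type) (e : A -> B) (u : nat -> seq (option A))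
    (s : seq A) :
  map e (insts u s) = insts (fun j => map (omap e) (u j)) (map e s).
Proof.
elim: s u => //= a s IH u; rewrite map_cat IH; congr (_ :: _ ++ _).
by rewrite -!map_comp; apply: eq_map => -[].
Qed.

Lemma insts_rcons (A : Type) (u : nat -> seq (option A)) (s : seq A) (a : A) :
  insts u (rcons s a) = insts u s ++ inst a (u (size s)).
Proof. by elim: s u => [|b s IH] u /=; rewrite ?cats0// IH catA. Qed.

Lemma size_insts (A B : Type) (u : nat -> seq (option A))
    (v : nat -> seq (option B)) (s : seq A) (t : seq B) :
  (forall j, size (u j) = size (v j)) -> size s = size t ->
  size (insts u s) = size (insts v t).
Proof.
elim: s u v t => [|a s IH] u v [|b t]//= uv [st].
by rewrite !size_cat !size_map uv (IH _ (v \o succn) t)// => j; exact: uv.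
Qed.

(* The Halpern-Lauchli theorem for the cones above the nodes of length [n]: it
   is the Carlson-Simpson theorem for the alphabet of 0-1 labellings of these
   nodes, a word being the family of the binary words read off at each node. *)
Lemma halpern_lauchli (n : nat) (Z : set node) (h : set node -> bool) :
  (forall y, Z y -> size y = n) ->
  exists (g : node -> node) (c : bool),
    [/\ strong_embedding g, forall s, (size s < n)%N -> g s = s,
        forall s, (n <= size s)%N -> prefix (take n s) (g s) &
        forall (x : node -> node) N,
          (forall y, Z y -> prefix y (x y) /\ size (x y) = N) ->
          h [set g (x y) | y in Z] = c].
Proof.
move=> Zn.
(* A letter assigns a digit to every node of length [n], and [e y] reads it at [y]; the default of
   [insubd] is reached only by words of other lengths. *)
pose A : finType := {ffun n.-tuple bool -> bool}.
pose e (y : node) (a : A) := a (insubd [tuple of nseq n false] y).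
have [w [u [c hc]]] :=
  @carlson_simpson A (fun v => h [set y ++ map (e y) v | y in Z]).
pose ue y j := map (omap (e y)) (u j).
(* From level [n] on, the later digits of a node are substituted for the variables of the words read
   at its restriction to [n]. *)
pose g s := if (size s < n)%N then s else
  take n s ++ map (e (take n s)) w ++ insts (ue (take n s)) (drop n s).
have gE y z : size y = n ->
    g (y ++ z) = y ++ map (e y) w ++ insts (ue y) z.
  move=> yn; rewrite /g size_cat yn ltnNge leq_addr /= take_cat drop_cat yn.
  by rewrite ltnn subnn take0 drop0 cats0.
exists g, c; split.
- split=> [s i|s t st]; last first.
    rewrite /g st; case: ltnP => // le_n.
    rewrite !size_cat !size_map !size_takel ?st//; congr (_ + (_ + _))%N.
    apply: size_insts; last by rewrite !size_drop st.
    by move=> j; rewrite /ue !size_map.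
  have [lt_n|le_n] := ltnP (size s) n.
    rewrite {1}/g lt_n /g size_rcons; have [_|le_n] := ltnP (size s).+1 n.
      exact: prefix_refl.
    by rewrite take_oversize ?size_rcons// prefix_prefix.
  rewrite -(cat_take_drop n s) rcons_cat !gE ?size_takel// insts_rcons !catA.
  by rewrite -(cats1 _ i) prefix_catr// eqxx prefix_cons eqxx prefix0s.
- by move=> s; rewrite /g => ->.
- by move=> s le_n; rewrite /g (ltnNge (size s)) le_n /= prefix_prefix.
move=> x N xP.
(* Since the [x y] share the length [N], a single word codes them all: its [j]-th letter holds their
   [j]-th digits past level [n]. Labels outside [Z] are arbitrary. *)
pose s : seq A :=
  mkseq (fun j => [ffun t : n.-tuple bool => nth false (drop n (x t)) j]) (N - n).
rewrite -(hc s); congr h; apply: eq_imagel => y Zy.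
have [/prefixP[z xE] xN] := xP _ Zy; have yn := Zn _ Zy.
have zn : size z = (N - n)%N by rewrite -xN xE size_cat yn addKn.
rewrite xE gE// map_cat map_insts; congr (_ ++ (_ ++ insts _ _)).
apply: (@eq_from_nth _ false); first by rewrite size_map size_mkseq.
move=> j; rewrite zn => lt_j.
rewrite (nth_map [ffun => false]) ?size_mkseq// nth_mkseq// /e ffunE.
rewrite insubdK ?xE; first by rewrite drop_cat yn ltnn subnn drop0.
exact/eqP.
Qed.

(** * Approximations and the maximal nodes of [B] *)

Lemma approx_emb (T : coded_tree) f k : strong_embedding f ->
  nodes T = range f ->
  (forall n s, size s = n -> size (code T n) = size (f s)) ->
  approx k T = [set f s | s in [set s | (size s < k)%N]].
Proof.
move=> fe TE codeE; rewrite /approx TE (codeE _ (nseq k false)) ?size_nseq//.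
apply/seteqP; split=> [_ [[s _ <-]]|_ [s /= lt_sk <-]].
  by rewrite emb_size// size_nseq; exists s.
by split; [exact: imageP|rewrite emb_size// size_nseq].
Qed.

Lemma max_nodes_emb f k : strong_embedding f ->
  max_nodes [set f s | s in [set s | (size s < k.+1)%N]] =
  [set f s | s in [set s | size s = k]].
Proof.
move=> fe; apply/seteqP; split=> [_ [[s /= lt_sk <-] smax]|_ [s /= sk <-]].
  exists s => //=; apply/eqP; rewrite eqn_leq -ltnS lt_sk leqNgt.
  apply/negP => sk.
  have /(emb_inj fe)/(congr1 size)/eqP : f (rcons s false) = f s.
    apply: smax; first by exists (rcons s false); rewrite //= size_rcons ltnS.
    by rewrite emb_prefixE// prefix_rcons.
  by rewrite size_rcons -[_ == _]negbK neq_ltn ltnSn orbT.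
split=> [|_ [t /= lt_tk <-]]; first by exists s; rewrite //= sk.
by rewrite emb_prefixE// => /prefix_anti -> //; rewrite sk -ltnS.
Qed.

(** An approximation is thus determined by its top level, so coloring approximations amounts to
    coloring level sets. A node below the top is the meet of its extensions by ones and by zeros. *)
Lemma meet_closure_emb f k : strong_embedding f ->
  [set f s | s in [set s | (size s < k.+1)%N]] =
  [set meet u v | u in [set f s | s in [set s | size s = k]]
                & v in [set f s | s in [set s | size s = k]]].
Proof.
move=> fe; apply/seteqP.
split=> [_ [s /= sk <-]|_ [_ [s /= sk <-]] [_ [t /= tk <-]] <-].
  pose ext i := s ++ nseq (k - size s) i.
  have extk i : size (ext i) = k by rewrite size_cat size_nseq subnKC.
  exists (f (ext true)); first by exists (ext true).
  exists (f (ext false)); first by exists (ext false).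
  rewrite -emb_meet// /ext; case: (k - size s)%N => [|j].
    by rewrite !cats0 meet_prefix// prefix_refl.
  by rewrite /= (@meet_branch _ _ _ true).
exists (meet s t); last by rewrite emb_meet.
by rewrite /= ltnS -sk; apply/prefix_size/meet_prefixl.
Qed.

Lemma card_words k : [set s : node | size s = k] #= `I_(2 ^ k).
Proof.
have cardE : (2 ^ k)%N = #|{: k.-tuple bool}| by rewrite card_tuple card_bool.
pose f (i : 'I_(2 ^ k)) : node := tval (enum_val (cast_ord cardE i)).
have finj : {in [set: 'I_(2 ^ k)] &, injective f}.
  by move=> i j _ _ /val_inj/enum_val_inj/cast_ord_inj.
have <- : f @` setT = [set s | size s = k].
  apply/seteqP; split=> [_ [i _ <-]|s /= sk]; first exact: size_tuple.
  have sP : size s == k by apply/eqP.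
  exists (cast_ord (esym cardE) (enum_rank (Tuple sP))) => //.
  by rewrite /f cast_ordKV enum_rankK.
rewrite (card_eq_trans (inj_card_eq finj))// card_eq_sym; exact: card_II.
Qed.

Lemma max_nodes_above (A : set node) N t :
  (forall u, A u -> (size u <= N)%N) -> A t ->
  exists2 s, max_nodes A s & prefix t s.
Proof.
move=> AN; move: {2}(N - size t)%N (leqnn (N - size t)) => d.
elim: d t => [|d IH] t le_d At.
  exists t; last exact: prefix_refl.
  split=> // u Au tu; apply/esym/prefix_anti => //.
  by apply: leq_trans (AN _ Au) _; rewrite -subn_eq0 -leqn0.
have [tmax|] := pselect (max_nodes A t); first by exists t; rewrite ?prefix_refl.
move=> /not_andP[//|/existsNP[u /not_implyP[Au /not_implyP[tu ut]]]].
have lt_tu : (size t < size u)%N.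
  by rewrite ltnNge; apply/negP => /(prefix_anti tu)/esym.
have [|s smax us] := IH u _ Au.
  rewrite -ltnS (leq_trans _ le_d)// ltn_sub2l// (leq_trans lt_tu)//.
  exact: AN.
by exists s => //; apply: prefix_trans tu us.
Qed.

(** Serves both cases for [B]. A node of [A] lies below a maximal node of [A], which has a successor
    in [Y]; comparable members of [Y] succeed comparable maximal nodes of [A], hence the same
    one. *)
Lemma max_nodes_setU_successors (A Y : set node) N :
  (forall u, A u -> (size u <= N)%N) ->
  (forall t, Y t -> exists2 s, max_nodes A s & exists i, t = rcons s i) ->
  (forall s, max_nodes A s -> exists i, Y (rcons s i)) ->
  max_nodes (A `|` Y) = Y.
Proof.
move=> AN YA AY; apply/seteqP; split=> [t [[At|//] tmax]|t Yt].
  have [s smax ts] := max_nodes_above AN At; have [i Ysi] := AY _ smax.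
  have siE : rcons s i = t.
    by apply: tmax; [right|apply: prefix_trans ts (prefix_rcons _ _)].
  by have := prefix_size ts; rewrite -siE size_rcons ltnn.
split=> [|u ABu tu]; first by right.
have [s [As smax] [i tE]] := YA _ Yt.
have su : prefix s u by apply: prefix_trans tu; rewrite tE prefix_rcons.
have lt_su : (size s < size u)%N.
  by have := prefix_size tu; rewrite tE size_rcons.
case: ABu => [Au|Yu]; first by rewrite (smax _ Au su) ltnn in lt_su.
have [s' [As' _] [j uE]] := YA _ Yu.
have s'E : s' = s.
  apply: smax => //; apply: (@prefix_comparable _ _ u) => //.
    by rewrite uE prefix_rcons.
  by rewrite -ltnS (leq_trans lt_su)// uE size_rcons.
by apply/esym/prefix_anti => //; rewrite tE uE s'E !size_rcons.
Qed.

(* For [y = rcons s i], the immediate successor of [f s] below [f y]. *)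
Definition succ_emb (f : node -> node) (y : node) : node :=
  rcons (f (take (size y).-1 y)) (last false y).

Lemma succ_emb_rcons f s i : succ_emb f (rcons s i) = rcons (f s) i.
Proof. by rewrite /succ_emb size_rcons last_rcons -(cats1 s) take_size_cat. Qed.

Lemma successors_emb f k :
  [set t | exists2 s, [set f s | s in [set s | size s = k]] s &
           exists i, t = rcons s i] =
  [set succ_emb f y | y in [set y | size y = k.+1]].
Proof.
apply/seteqP; split=> [_ [_ [s /= sk <-] [i ->]]|_ [y /= yk <-]].
  by exists (rcons s i); rewrite ?succ_emb_rcons//= size_rcons sk.
elim/last_ind: y yk => // s i _; rewrite size_rcons succ_emb_rcons => -[sk].
by exists (f s); [exists s|exists i].
Qed.

Lemma succ_emb_inj f (y z : node) : strong_embedding f -> size y = size z ->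
  succ_emb f y = succ_emb f z -> y = z.
Proof.
move=> fe; elim/last_ind: y => [/esym/size0nil //|s i _].
elim/last_ind: z => [/size0nil //|t j _ _].
by rewrite !succ_emb_rcons => /rcons_inj[/(emb_inj fe) -> ->].
Qed.

(** In case (a), [A] has 2^(k-1) maximal nodes and both successors of each are taken; in case (b),
    it has 2^k and one successor of each is taken. *)
Lemma max_nodes_card (E : rel nat) (T : coded_tree) (k : nat) (A B : set node) :
  hatAT_in E T A -> case_a E T k A B \/ case_b k A B ->
  max_nodes B #= `I_(2 ^ k) /\
  forall t, max_nodes B t -> exists2 s, max_nodes A s & exists i, t = rcons s i.
Proof.
move=> [A' [l [_ _ _ AE]]] AB.
have Al u : A u -> (size u <= l)%N.
  rewrite AE => -[[_ /ltnW //]|[t _ <-]].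
  by rewrite size_take_min geq_minl.
pose Y := [set t | exists2 s, max_nodes A s & exists i : bool, t = rcons s i].
have maxplus : max_nodes (plus A) = Y.
  apply: (max_nodes_setU_successors Al) => // s smax.
  by exists true, s => //; exists true.
case: AB => [[k_gt0 [[T' T'E T'A] _] BE]|[_ Acard [Y' [Y'Y Y'A BE]]]].
  have [f [fe T'f codeE]] := TR_emb T'E.
  case: k k_gt0 T'A => // k _ T'A.
  have AE' := approx_emb k.+1 fe T'f codeE.
  have YE : Y = [set succ_emb f y | y in [set y | size y = k.+1]].
    by rewrite /Y -successors_emb -T'A AE' max_nodes_emb.
  rewrite BE maxplus; split=> //; rewrite YE.
  apply: card_eq_trans (card_words _); apply: inj_card_eq => y z.
  by rewrite !inE => yk zk; apply: succ_emb_inj; rewrite ?yk.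
have maxB : max_nodes B = Y'.
  rewrite BE; apply: (max_nodes_setU_successors Al) => [t /Y'Y|s /Y'A[i []]].
    by rewrite maxplus.
  by exists i.
rewrite maxB; split; last by move=> t /Y'Y; rewrite maxplus.
have /choice[g gP] s : exists i, max_nodes A s -> Y' (rcons s i).
  have [smax|] := pselect (max_nodes A s); last by exists true.
  by have [i [Yi _]] := Y'A _ smax; exists i.
have -> : Y' = [set rcons s (g s) | s in max_nodes A].
  apply/seteqP; split=> [t Y't|_ [s smax <-]]; last exact: gP.
  have : Y t by rewrite -maxplus; exact: Y'Y.
  move=> [s smax [i tE]]; exists s => //; rewrite tE; congr rcons.
  have [j [_ juniq]] := Y'A _ smax.
  by rewrite -(juniq _ (gP _ smax)) (juniq i)// -tE.
by apply: card_eq_trans Acard; apply: inj_card_eq => s t _ _ /rcons_inj[].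
Qed.

Lemma card_II_nonempty (T : Type) (A : set T) m :
  A #= `I_m -> (0 < m)%N -> A !=set0.
Proof.
move=> Am m_gt0; apply/set0P/negP => A0.
by move: A0; rewrite -(@card_eq0 _ nat) (card_eql Am) card_eq0 => /eqP I0;
  have : `I_m 0 by []; rewrite I0.
Qed.

(** * From colorings of approximations to colorings of level products *)

Theorem theorem4p3 (E : rel nat) (hE : rado_graph E)
  (T : coded_tree) (hT : TR E T) (n : nat) (D : set node)
  (hD : D = approx n T)
  (A : set node) (hA : hatAT_in E T A) (hAD : max_nodes A `<=` max_nodes D)
  (k : nat) (B : set node) (hB : hatAT_max E B)
  (hAB : case_a E T k A B \/ case_b k A B)
  (h : set node -> bool) :
  exists2 S : coded_tree, basic E D T S &
    exists c : bool, forall C, approx_star E k.+1 B S C -> h C = c.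
Proof.
have [Bcard Bsucc] := max_nodes_card hA hAB.
have [f [fe TE codeE]] := TR_emb hT.
rewrite (approx_emb _ fe TE codeE) in hD.
have [b0 Bb0] : max_nodes B !=set0.
  by apply: card_II_nonempty Bcard _; rewrite expn_gt0.
(* [approx 0 T] is empty, whereas [D] has a maximal node below [b0]. *)
have [n' nE] : exists n', n = n'.+1.
  have [s /hAD + _] := Bsucc _ Bb0; rewrite hD.
  case: (n) => [|n' _]; last by exists n'.
  by case=> -[t].
rewrite nE in hD *; have Dmax := max_nodes_emb n' fe; rewrite -hD in Dmax.
(* Through [succ_emb f], words of length [n] parametrize the immediate successors of the top nodes
   of [D]; the maximal nodes of [B] are among these. *)
pose Z := [set y | size y = n'.+1 /\ max_nodes B (succ_emb f y)].
have BZ t : max_nodes B t -> exists2 y, Z y & succ_emb f y = t.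
  move=> Bt; have [s /hAD] := Bsucc _ Bt; rewrite Dmax => sD si.
  have : [set succ_emb f y | y in [set y | size y = n'.+1]] t.
    by rewrite -successors_emb; exists s.
  by move=> [y yn yt]; exists y => //; split=> //; rewrite yt.
(* A level set gets the color of the meet closure of its image under [f]. *)
have [g [c [ge glt gpre gc]]] := @halpern_lauchli n'.+1 Z
  (fun X => h [set meet u v | u in [set f x | x in X]
                            & v in [set f x | x in X]])
  (fun y Zy => Zy.1).
have Fe := emb_comp fe ge.
exists (emb_tree E Fe).
  split; first exact: emb_tree_TR.
    by rewrite /subtree TE => _ [s _ <-]; exact: imageP.
  (* As [g] fixes all words shorter than [n'.+1], this approximation of the new tree is still
     [D]. *)
  exists n'.+1; rewrite (approx_emb _ Fe)//; last first.
    by move=> j s sj; apply: Fe.2; rewrite size_mkseq.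
  rewrite hD; apply: eq_imagel => s /= sn.
  by rewrite glt.
exists c => _ [S' [S'TR S'S [m _ [g0 [g0fun g0inj g0surj] g0pre]]] <-].
have [f' [f'e S'E codeE']] := TR_emb S'TR.
have g0B : g0 @` max_nodes B = max_nodes (approx m S').
  by apply/seteqP; split=> [_ [t Bt <-]|t /g0surj//]; exact: g0fun.
(* Counting: the top of [approx m S'] has 2^(m-1) nodes and is in bijection with the 2^k maximal
   nodes of [B]. *)
have mE : m = k.+1.
  have : max_nodes (approx m S') #= `I_(2 ^ k).
    by rewrite -g0B; apply: card_eq_trans Bcard; exact: inj_card_eq.
  rewrite (approx_emb _ f'e S'E codeE'); case: (m) => [|m'].
    move=> /card_II_nonempty; rewrite expn_gt0 => /(_ isT)[t [[s]]].
    by rewrite /= ltn0.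
  rewrite max_nodes_emb// => cm.
  have : `I_(2 ^ m') #= `I_(2 ^ k).
    apply: card_eq_trans cm; rewrite card_eq_sym.
    apply: card_eq_trans (card_words _); apply: inj_card_eq => s t _ _.
    exact: emb_inj.
  by move=> /card_eq_II/eqP; rewrite eqn_exp2l// => /eqP ->.
rewrite mE (approx_emb _ f'e S'E codeE') (max_nodes_emb _ f'e) in g0fun g0surj.
rewrite (approx_emb _ f'e S'E codeE') (meet_closure_emb _ f'e).
(* [x y] is the preimage under [f \o g] of the top node lying above [succ_emb f y]; outside [Z] a
   default is used. *)
have /choice[x xP] y : exists t, Z y -> g0 (succ_emb f y) = f (g t).
  have [Zy|] := pselect (Z y); last by exists [::].
  have [s _ sE] := g0fun _ Zy.2.
  have : nodes S' (f' s) by rewrite S'E; exact: imageP.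
  by move=> /S'S[t _ tE]; exists t => _; rewrite -sE -tE.
have -> : [set f' s | s in [set s | size s = k]] =
    [set f x | x in [set g (x y) | y in Z]].
  rewrite image_comp; apply/seteqP.
  split=> [t /g0surj[b /BZ[y Zy <-] <-]|_ [y Zy <-]].
    by exists y => //; rewrite /= -xP.
  by rewrite /= -xP//; exact: (g0fun _ Zy.2).
have [y0 Zy0 _] := BZ _ Bb0.
(* The top nodes have equal length and [f \o g] reflects equality of lengths, so any [y0] in [Z]
   gives the common length. *)
apply: (gc x (size (x y0))) => y Zy; split; last first.
  apply: (emb_size_eq Fe); rewrite /= -!xP//.
  have [s /= sk <-] := g0fun _ Zy.2; have [s0 /= s0k <-] := g0fun _ Zy0.2.
  by apply: f'e.2; rewrite sk.
have [yn Bsy] := Zy; have pre := g0pre _ Bsy; rewrite xP// in pre.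
have {Bsy Zy}[s [i yE]] : exists s i, y = rcons s i.
  by case/lastP: (y) yn => // s i _; exists s, i.
have sn : size s = n' by move: yn; rewrite yE size_rcons => -[].
have {}pre : prefix (rcons (f s) i) (f (g (x y))).
  by rewrite -succ_emb_rcons -yE.
have lt_n : (n' < size (g (x y)))%N.
  rewrite -sn -(emb_size _ _ fe).
  by have := prefix_size pre; rewrite size_rcons.
(* Otherwise [g] would fix [x y], although [g (x y)] is longer than [n']. *)
have le_n : (n'.+1 <= size (x y))%N.
  rewrite leqNgt; apply/negP => lt_x.
  by rewrite (glt _ lt_x) ltnNge -ltnS lt_x in lt_n.
have := gpre _ le_n; move: (prefix_take (x y) n'.+1).
have : size (take n'.+1 (x y)) = n'.+1 by rewrite size_takel.
case/lastP: (take _ _) => // t j; rewrite size_rcons => -[tn] tx tg.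
have tpre := emb_rcons fe tg.
(* Both are initial segments of [f (g (x y))] of the same length. Hence [y] is the restriction
   [rcons t j] of [x y]. *)
have : rcons (f s) i = rcons (f t) j.
  have sz : size (rcons (f s) i) = size (rcons (f t) j).
    by rewrite !size_rcons (fe.2 s t) ?sn.
  apply: prefix_anti; last by rewrite sz.
  by apply: prefix_comparable tpre _; rewrite ?sz.
by move=> /rcons_inj[/(emb_inj fe) st ij]; rewrite {1}yE st ij.
Qed.
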